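(* Let $X$ be a nuclear Fréchet space over $\mathbb{C}$ and let $\{\Omega_\theta\}_{\theta\in\mathbb{R}}$ be a differentiable one-parameter subgroup of $GL(X)$. Then $\{\Omega_\theta\}_{\theta\in\mathbb{R}}$ is regular.
   Context: The topology of $X$ is given by an increasing sequence of Hilbertian seminorms $(|\cdot|_n)_{n\in\mathbb{N}}$. $L(X)$ is the space of continuous linear operators on $X$ and $GL(X)$ the group of linear homeomorphisms of $X$. A one-parameter subgroup of $GL(X)$ is a family $\{\Omega_\theta\}_{\theta\in\mathbb{R}}\subset L(X)$ with $\Omega_{\theta_1+\theta_2}=\Omega_{\theta_1}\circ\Omega_{\theta_2}$ for all $\theta_1,\theta_2\in\mathbb{R}$ and $\Omega_0=\mathrm{Id}$. A family $\{\Omega_\theta\}_{\theta\in\mathbb{R}}\subset L(X)$ is differentiable in $\theta_0$ if $\Omega'_{\theta_0}\phi:=\lim_{\theta\to\theta_0}\frac{\Omega_\theta\phi-\Omega_{\theta_0}\phi}{\theta-\theta_0}$ converges in $X$ for any $\phi\in X$, and differentiable if this holds at each $\theta_0\in\mathbb{R}$. It is regularly differentiable in $\theta_0$ if there exists $\Omega'_{\theta_0}\in L(X)$ such that for any $n\in\mathbb{N}$ there exists $m\in\mathbb{N}$ with $$\lim_{\theta\to\theta_0}\sup_{|\phi|_m\le1}\left|\frac{\Omega_\theta\phi-\Omega_{\theta_0}\phi}{\theta-\theta_0}-\Omega'_{\theta_0}\phi\right|_n=0,$$ and regular if it is regularly differentiable at each $\theta_0\in\mathbb{R}$. *)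

(* Defs.v *)
From mathcomp Require Import all_boot all_order all_algebra.
From mathcomp Require Import complex.
From mathcomp Require Import all_classical all_reals all_analysis.

Set Implicit Arguments.
Unset Strict Implicit.
Unset Printing Implicit Defensive.

Import Order.TTheory GRing.Theory Num.Theory.
Import numFieldNormedType.Exports.

Local Open Scope classical_set_scope.
Local Open Scope complex_scope.
Local Open Scope ring_scope.

Section Seminorms.
Variables (R : realType) (X : lmodType R[i]).

Definition seminorm (p : X -> R) : Prop :=
  (forall x y, p (x + y) <= p x + p y) /\
  (forall (a : R[i]) x, (p (a *: x))%:C = `|a| * (p x)%:C).

(* The Hermitian form [h] is automatically positive semidefinite. *)
Definition hilbertian_seminorm (p : X -> R) : Prop :=
  seminorm p /\
  exists h : {hermitian X for false & (@Num.conj R[i])},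
    forall x, h x x = (p x ^+ 2)%:C.

(* [(B, j)] is the Banach space obtained by completing X / ker p; [j] is the
   canonical map X -> X / ker p -> B. *)
Definition is_local_banach_space (p : X -> R) (B : completeNormedModType R[i])
    (j : {linear X -> B}) : Prop :=
  (forall x, `|j x| = (p x)%:C) /\ dense (range j).

End Seminorms.

(* T = \sum_k lam_k f_k(.) y_k with lam in l^1, (f_k) in the unit ball of the
   dual of E and (y_k) in the unit ball of F. *)
Definition nuclear_operator (R : realType) (E F : normedModType R[i])
    (T : E -> F) : Prop :=
  exists (lam : nat -> R) (f : nat -> {scalar E}) (y : nat -> F),
    [/\ cvgn [normed series lam],
        forall k x, `|f k x| <= `|x|,
        forall k, `|y k| <= 1
      & forall x, (\sum_(0 <= k < N) ((lam k)%:C * f k x) *: y k)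
                    @[N --> \oo] --> T x].

Section Spaces.
Variables (R : realType) (X : tvsType R[i]).

(* Grothendieck's definition; [T] is the canonical map between the local
   Banach spaces of q and p. *)
Definition nuclear_space : Prop :=
  forall p : X -> R, seminorm p -> continuous p ->
  exists q : X -> R,
    [/\ seminorm q, continuous q, (forall x, p x <= q x) &
      exists (Bq Bp : completeNormedModType R[i])
          (jq : {linear X -> Bq}) (jp : {linear X -> Bp})
          (T : {linear Bq -> Bp}),
        [/\ is_local_banach_space q jq, is_local_banach_space p jp,
            forall x, T (jq x) = jp x & nuclear_operator T]].

(* Cauchy filters are those of the translation-invariant uniformity.  The
   uniform structure carried by a [tvsType] is only required to induce the
   topology, so the library's [cauchy] would be the wrong notion. *)
Definition tvs_complete : Prop :=
  forall F : set_system X, ProperFilter F ->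
    xy.1 - xy.2 @[xy --> filter_prod F F] --> (0 : X) ->
    exists l : X, F --> l.

Definition increasing_seminorms (p : nat -> X -> R) : Prop :=
  forall n x, p n x <= p n.+1 x.

(* For an increasing sequence the balls of the single seminorms form a base of
   neighbourhoods of 0: no finite intersections are needed. *)
Definition topology_given_by (p : nat -> X -> R) : Prop :=
  forall U : set X, nbhs (0 : X) U <->
    exists (n : nat) (e : R), 0 < e /\ [set x | p n x < e] `<=` U.

(* Metrizability is the existence of the sequence [p]. *)
Definition frechet_space (p : nat -> X -> R) : Prop :=
  [/\ hausdorff_space X, tvs_complete, forall n, seminorm (p n),
      increasing_seminorms p & topology_given_by p].

(* Membership in GL(X) follows from the group law. *)
Definition one_parameter_subgroup (Omega : R -> {linear X -> X}) : Prop :=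
  [/\ forall t, continuous (Omega t),
      forall s t x, Omega (s + t) x = Omega s (Omega t x)
    & forall x, Omega 0 x = x].

Definition diff_quotient (Omega : R -> {linear X -> X}) (t0 t : R) (x : X) : X :=
  ((t - t0)^-1)%:C *: (Omega t x - Omega t0 x).

Definition differentiable_at (Omega : R -> {linear X -> X}) (t0 : R) : Prop :=
  forall x, exists l : X, diff_quotient Omega t0 t x @[t --> t0^'] --> l.

Definition differentiable_family (Omega : R -> {linear X -> X}) : Prop :=
  forall t0, differentiable_at Omega t0.

(* The supremum is taken in [\bar R]: it may be infinite away from [t0]. *)
Definition regularly_differentiable_at (p : nat -> X -> R)
    (Omega : R -> {linear X -> X}) (t0 : R) : Prop :=
  exists2 D : {linear X -> X}, continuous D &
    forall n, exists m,
      ereal_sup [set (p n (diff_quotient Omega t0 t x - D x))%:E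
                | x in [set x | p m x <= 1]]
        @[t --> t0^'] --> 0%:E.

Definition regular_family (p : nat -> X -> R)
    (Omega : R -> {linear X -> X}) : Prop :=
  forall t0, regularly_differentiable_at p Omega t0.

End Spaces.

(* Main.v *)
Require Import Defs.
From HB Require Import structures.
From mathcomp Require Import all_boot all_order all_algebra.
From mathcomp Require Import complex.
From mathcomp Require Import all_classical all_reals all_analysis.
From mathcomp Require Import ring lra.

Set Implicit Arguments.
Unset Strict Implicit.
Unset Printing Implicit Defensive.

Import Order.TTheory GRing.Theory Num.Theory.
Import numFieldNormedType.Exports.

Local Open Scope classical_set_scope.
Local Open Scope complex_scope.
Local Open Scope ring_scope.

(** Near t0 the difference quotients are pointwise bounded, since they
    converge pointwise, and so in a Fréchet space they are equicontinuous near
    t0: a seminorm [p n] of the quotient is at most [C * p m], uniformly in t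
    ([uniform_boundedness], [diff_quotient_equicontinuous]).  The pointwise
    limit D inherits this bound and is a continuous operator
    ([derivative_exists]).

    An equicontinuous family that converges pointwise converges uniformly on
    totally bounded sets.  Nuclearity supplies such a set: the unit ball of
    some [p m'] is totally bounded for [p m], because the canonical map between
    the local Banach spaces is a norm limit of finite-rank operators
    ([nuclear_ball_totally_bounded]).  Concretely, each x in that ball is
    within [eps] for [p m] of a combination of finitely many fixed vectors z_k,
    with coefficients bounded independently of x; the difference between D and
    the quotient is small on the z_k by pointwise convergence, and small on the
    remainder by equicontinuity. *)

(** * Seminorms *)

Lemma normc_real (R : realType) (r : R) : `|r%:C| = `|r|%:C.
Proof. by rewrite normc_def /= expr0n /= addr0 sqrtr_sqr. Qed.

Section SeminormTheory.
Variables (R : realType) (X : lmodType R[i]) (p : X -> R).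
Hypothesis sp : seminorm p.

Lemma seminormD x y : p (x + y) <= p x + p y.
Proof. exact: sp.1. Qed.

Lemma seminormZ (r : R) x : p (r%:C *: x) = `|r| * p x.
Proof.
apply/eqP; rewrite eq_le -!lecR.
by rewrite sp.2 normc_real -rmorphM /= lexx.
Qed.

Lemma seminormZ_le (a : R[i]) (c : R) x :
  0 <= p x -> `|a| <= c%:C -> p (a *: x) <= c * p x.
Proof. by move=> px ac; rewrite -lecR sp.2 rmorphM ler_wpM2r ?ler0c. Qed.

Lemma seminorm0 : p 0 = 0.
Proof. by have := seminormZ 0 0; rewrite scaler0 normr0 mul0r. Qed.

Lemma seminormN x : p (- x) = p x.
Proof.
have := seminormZ (-1) x.
by rewrite rmorphN1 scaleN1r normrN1 mul1r.
Qed.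

Lemma seminorm_ge0 x : 0 <= p x.
Proof.
have := seminormD x (- x); rewrite subrr seminorm0 seminormN -mulr2n.
by rewrite pmulrn_lge0.
Qed.

Lemma seminormB x y : p (x - y) <= p x + p y.
Proof. by rewrite -(seminormN y) seminormD. Qed.

Lemma seminorm_sum (I : Type) (s : seq I) (F : I -> X) :
  p (\sum_(i <- s) F i) <= \sum_(i <- s) p (F i).
Proof.
elim: s => [|i s IH]; first by rewrite !big_nil seminorm0.
by rewrite !big_cons (le_trans (seminormD _ _))// lerD2l.
Qed.

End SeminormTheory.

(** A seminorm bounded on a ball is bounded by homogeneity everywhere; the
    slack [d] lets the scaled point enter the open ball even when [p x = 0]. *)
Lemma seminorm_le_of_ball (R : realType) (X : lmodType R[i]) (p q : X -> R)
    (e c : R) : seminorm p -> seminorm q -> 0 < e ->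
  (forall x, p x < e -> q x <= c) -> forall x, q x <= c / e * p x.
Proof.
move=> sp sq e0 H x.
have c0 : 0 <= c.
  by rewrite -(seminorm0 sq) H// seminorm0.
suff Hd d : 0 < d -> q x <= c / e * (p x + d).
  have [ce0|ce0] := eqVneq (c / e) 0.
    by have := Hd 1 ltr01; rewrite ce0 !mul0r.
  have cegt0 : 0 < c / e by rewrite lt_neqAle eq_sym ce0 divr_ge0// ltW.
  apply/ler_addgt0Pr => d d0.
  have := Hd (d / (c / e)) (divr_gt0 d0 cegt0).
  by rewrite mulrDr [_ * (d / _)]mulrC divfK.
move=> d0.
have s0 : 0 < p x + d by rewrite ltr_wpDl// seminorm_ge0.
have k0 : 0 < e / (p x + d) by rewrite divr_gt0.
have /H : p ((e / (p x + d))%:C *: x) < e.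
  rewrite seminormZ// gtr0_norm// mulrAC ltr_pdivrMr// ltr_pM2l//.
  by rewrite ltrDl.
rewrite seminormZ// gtr0_norm// -ler_pdivlMl// => /le_trans; apply.
by rewrite invf_div mulrAC -mulrA mulrC lexx.
Qed.


(** * Fréchet spaces *)

Section Frechet.
Variables (R : realType) (X : tvsType R[i]) (p : nat -> X -> R).
Hypothesis frX : frechet_space p.

Let sp n : seminorm (p n). Proof. by case: frX. Qed.

Lemma frechet_seminorm_le m n x : (m <= n)%N -> p m x <= p n x.
Proof.
move=> /subnK <-; elim: (n - m)%N => // k IH.
by rewrite addSn (le_trans IH)//; case: frX => _ _ _ + _; apply.
Qed.

Lemma frechet_cvgP (F : set_system X) (l : X) : Filter F ->
  F --> l <-> forall n e, 0 < e -> \forall x \near F, p n (x - l) < e.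
Proof.
move=> FF; have [_ _ _ _ top] := frX; split => [Fl n e e0|H A Al].
  have : nbhs (0 : X) [set x | p n x < e] by apply/top; exists n, e; split.
  move=> /(nbhsT l) /Fl; apply: filterS => _ [y ye <-].
  by rewrite addrAC subrr add0r.
have /top [n [e [e0 sub]]] : nbhs (0 : X) [set - l + x | x in A].
  by have := nbhsB (- l) Al; rewrite addNr.
apply: filterS (H n e e0) => x /sub [y Ay] yx.
suff -> : x = y by [].
by move: yx; rewrite addrC => /addIr.
Qed.

Lemma frechet_nbhs x n e : 0 < e -> \forall y \near x, p n (y - x) < e.
Proof. by move: n e; apply/(frechet_cvgP (F := nbhs x)); exact: cvg_id. Qed.

Lemma frechet_seminorm_continuous n : continuous (p n).
Proof.
move=> x; apply/cvgrPdist_lt => e e0.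
apply: filterS (frechet_nbhs x n e0) => y; apply: le_lt_trans.
have H u v : p n u - p n v <= p n (v - u).
  by rewrite lerBlDr -[v - u]opprB seminormN// -{1}(subrK v u) seminormD.
rewrite ler_norml lerNl opprB H.
by rewrite (le_trans (H _ _))// -opprB seminormN.
Qed.

Lemma frechet_eq0 x : (forall n, p n x = 0) -> x = 0.
Proof.
move=> x0; have [hX _ _ _ _] := frX.
apply: (cvg_unique hX (F := nbhs x)); first exact: cvg_id.
apply/frechet_cvgP => n e e0.
apply: filterS (frechet_nbhs x n e0) => y; apply: le_lt_trans.
by rewrite subr0 -{1}(subrK x y) (le_trans (seminormD _ _ _))// x0 addr0.
Qed.

Lemma continuous_seminorm_dominated (q : X -> R) :
  seminorm q -> continuous q ->
  exists m C, 0 < C /\ forall x, q x <= C * p m x.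
Proof.
move=> sq cq; have [_ _ _ _ top] := frX.
have /top [m [e [e0 sub]]] : nbhs (0 : X) [set x | q x < 1].
  have /cq : nbhs (q 0) [set y | y < 1].
    by apply: open_nbhs_nbhs; split; [exact: open_lt|rewrite /= seminorm0].
  exact.
exists m, (1 / e); split; first by rewrite divr_gt0.
by apply: seminorm_le_of_ball => // x /sub /ltW.
Qed.

(** The completeness assumption speaks of filters; the image filter of a
    sequence is Cauchy when the sequence is Cauchy for every seminorm. *)
Lemma frechet_sequence_complete (u : nat -> X) :
  (forall n e, 0 < e -> exists N, forall i j, (N <= i)%N -> (N <= j)%N ->
     p n (u i - u j) < e) ->
  exists l : X, u @ \oo --> l.
Proof.
move=> H; have [_ cX _ _ _] := frX.
apply: (cX (u @ \oo)).
apply/frechet_cvgP => n e e0.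
have [N HN] := H n e e0.
exists (u @` [set i | (N <= i)%N], u @` [set i | (N <= i)%N]) => /=.
  by split; exists N => // i Ni; exists i.
by move=> [_ _] /= [[i Ni <-] [j Nj <-]]; rewrite subr0 HN.
Qed.

End Frechet.

(** * Uniform boundedness *)

Section UniformBoundedness.
Variables (R : realType) (X : tvsType R[i]) (p : nat -> X -> R).
Hypothesis frX : frechet_space p.

Let sp n : seminorm (p n). Proof. by case: frX. Qed.
Let pm := frechet_seminorm_le frX.

(* (x, m, r) stands for the closed ball of centre x and radius r for p m *)
Let ball (s : X * nat * R) : set X := [set y | p s.1.2 (y - s.1.1) <= s.2].

(** The principle is stated along a filter with a countable decreasing base,
    so that boundedness of [q i x] is only asked eventually, at a place that
    may depend on x; a supremum over all indices would be too strong for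
    difference quotients, which are controlled only near one point.

    If no bound holds, then in every ball and every basic set of indices some
    [q i] exceeds any given constant on a smaller ball.  Nested balls obtained
    this way have a common point l, by completeness, and [q i l] is unbounded
    along the filter. *)
Theorem uniform_boundedness (I : Type) (F : set_system I) (B : nat -> set I)
    (q : I -> X -> R) : Filter F ->
  (forall k, F (B k)) ->
  (forall k l, (k <= l)%N -> B l `<=` B k) ->
  (forall A, F A -> exists k, B k `<=` A) ->
  (forall i, seminorm (q i)) -> (forall i, continuous (q i)) ->
  (forall x, exists M, \forall i \near F, q i x <= M) ->
  exists m C, 0 < C /\ \forall i \near F, forall x, q i x <= C * p m x.
Proof.
move=> FF FB Bmono Bbase sq cq bnd; apply: contrapT => unb.
have step (s : X * nat * R) : exists s' : X * nat * R, 0 < s.2 ->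
    [/\ (s.1.2 < s'.1.2)%N, 0 < s'.2, s'.2 <= s'.1.2.+1%:R^-1,
      ball s' `<=` ball s &
      exists2 i, B s.1.2 i & forall y, ball s' y -> s.1.2%:R < q i y].
  case: s => [[x m] r] /=.
  have [r0|] := ltP 0 r; last by move=> _; exists (x, m, r).
  have [i Bi [z zr qz]] : exists2 i, B m i &
      exists2 z, p m z < r / 2 & m.+1%:R < q i z.
    apply: contrapT => H; apply: unb.
    exists m, (m.+1%:R / (r / 2)); split; first by rewrite !divr_gt0.
    apply: filterS (FB m) => i Bi; apply: seminorm_le_of_ball => //.
      by rewrite divr_gt0.
    move=> z zr; rewrite leNgt; apply/negP => qz; apply: H.
    by exists i => //; exists z.
  (* since 2 z = (x + z) - (x - z), q i cannot be small at both points *)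
  have [x' xx' qx'] : exists2 x', p m (x' - x) < r / 2 & m.+1%:R < q i x'.
    have [h|h] := ltP m.+1%:R (q i (x + z)).
      by exists (x + z) => //; rewrite addrC addKr.
    exists (x - z); first by rewrite addrC addKr seminormN.
    have : q i (z + z) <= q i (x + z) + q i (x - z).
      have -> : z + z = x + z - (x - z) by rewrite opprB [RHS]addrC addrA subrK.
      exact: seminormB.
    rewrite -[z + z](scaler_nat 2) -[2%:R](rmorph_nat (real_complex R)).
    rewrite seminormZ// normr_nat; move: h qz; lra.
  (* radius at most 1 / C for an index above m' costs at most 1 in q i, which
     is why the previous bounds are m.+1 and not m *)
  have [m' [C [C0 qC]]] := continuous_seminorm_dominated frX (sq i) (cq i).
  pose k := (maxn m.+1 m').
  pose r' := Num.min (Num.min (r / 2) C^-1) k.+1%:R^-1.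
  exists (x', k, r') => _ /=; split.
  - by rewrite leq_maxl.
  - by rewrite !lt_min divr_gt0//= invr_gt0 C0 invr_gt0 ltr0n.
  - by rewrite ge_min lexx orbT.
  - move=> y; rewrite /ball/= => yx'; rewrite -[y - x](subrKA x').
    have : p m (y - x') <= r / 2.
      rewrite (le_trans (pm _ (leqW (leqnn m))))//.
      rewrite (le_trans (pm _ (leq_maxl _ m')))// (le_trans yx')//.
      by rewrite !ge_min lexx.
    have := seminormD (sp m) (y - x') (x' - x); move: xx'; lra.
  - exists i => // y; rewrite /ball/= => yx'.
    have h1 : q i (y - x') <= 1.
      rewrite (le_trans (qC _))// -ler_pdivlMl// mulr1.
      rewrite (le_trans (pm _ (leq_maxr m.+1 _)))// (le_trans yx')//.
      by rewrite !ge_min lexx orbT.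
    have := seminormB (sq i) y (y - x'); rewrite opprB addrC subrK.
    by move: qx' h1; rewrite -natr1; lra.
have [f fP] := choice step.
pose s k := iter k f (0, 0%N, 1).
have s0 k : 0 < (s k).2.
  by elim: k => [|k IH]; [exact: ltr01|case: (fP _ IH)].
have sk k : (k <= (s k).1.2)%N.
  elim: k => // k IH; case: (fP _ (s0 k)) => + _ _ _ _.
  exact: leq_ltn_trans.
have sub k l : (k <= l)%N -> ball (s l) `<=` ball (s k).
  move=> /subnK <-; elim: (l - k)%N => // j IH.
  rewrite addSn; case: (fP _ (s0 (j + k)%N)) => _ _ _ + _.
  by move=> /subset_trans; apply.
(* the centres are Cauchy: the balls are nested, and from the second one on
   their radii are at most 1 / (m + 1) for a growing index m *)
have cen k : ball (s k) (s k).1.1.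
  by rewrite /ball/= subrr seminorm0// ltW.
have [l sl] : exists l : X, (fun k => (s k).1.1) @ \oo --> l.
  apply: (frechet_sequence_complete frX) => n e e0.
  pose N := maxn n (Num.trunc (2 / e)).+1.
  exists N.+1 => i j Ni Nj.
  have small k : (N.+1 <= k)%N -> p n ((s k).1.1 - (s N.+1).1.1) < e / 2.
    move=> Nk; have := sub _ _ Nk _ (cen k).
    rewrite {1}/ball/= => h.
    case: (fP _ (s0 N)) => Ns _ rs _ _.
    have nN : (n <= (s N.+1).1.2)%N.
      by rewrite (leq_trans _ (sk _))// leqW// leq_maxl.
    rewrite (le_lt_trans (pm _ nN))// (le_lt_trans h)// (le_lt_trans rs)//.
    rewrite -[e / 2]invf_div ltf_pV2 ?posrE ?divr_gt0//.
    rewrite (lt_le_trans (truncnS_gt _))// ler_nat.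
    rewrite (leq_trans (leq_maxr n _))// -/N.
    by rewrite (leq_trans (leqnSn N))// (leq_trans (sk N.+1)).
  rewrite -(subrKA (s N.+1).1.1) (le_lt_trans (seminormD _ _ _))//.
  rewrite [e]splitr ltrD ?small//.
  by rewrite -opprB seminormN// small.
have lin k : ball (s k) l.
  rewrite /ball/=; apply/ler_addgt0Pr => e e0.
  have [N _ HN] := (frechet_cvgP frX l _).1 sl (s k).1.2 e e0.
  have := sub k (maxn k N) (leq_maxl _ _) _ (cen _); rewrite {1}/ball/= => h1.
  have := HN (maxn k N) (leq_maxr _ _) => /= h2.
  rewrite -(subrKA (s (maxn k N)).1.1) (le_trans (seminormD _ _ _))//.
  by rewrite addrC lerD// -opprB seminormN// ltW.
have [M /Bbase [k BM]] := bnd l.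
pose j := maxn k (Num.trunc M).+1.
case: (fP _ (s0 j)) => _ _ _ _ [i Bi /(_ l (lin j.+1))].
apply/negP; rewrite -leNgt (le_trans (BM i _))//.
  by apply: Bmono Bi; rewrite (leq_trans (leq_maxl _ _) (sk j)).
rewrite (le_trans (ltW (truncnS_gt _)))// ler_nat.
by rewrite (leq_trans (leq_maxr k _) (sk j)).
Qed.

End UniformBoundedness.

(** * Nuclearity *)

(** Total boundedness is stated in its linear form: the unit ball of [p m] lies
    within [eps], for [p n], of a bounded part of the span of finitely many
    vectors.  Truncating the nuclear series of T gives such a span in the local
    Banach space of [p n]; the y_k that generate it are then replaced by
    images of vectors of X, which are dense there.  Three errors arise, each at
    most [eps / 3]: the distance from T to a long partial sum of its series,
    the terms between the truncation N and that sum, and the replacement of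
    the y_k. *)
Lemma nuclear_ball_totally_bounded (R : realType) (X : tvsType R[i])
    (p : nat -> X -> R) (frX : frechet_space p) (nuX : nuclear_space X) n :
  exists m, forall eps : R, 0 < eps ->
  exists (N : nat) (z : nat -> X) (c : nat -> R),
    forall x, p m x <= 1 -> exists a : nat -> R[i],
      (forall k, `|a k| <= (c k)%:C) /\
      p n (x - \sum_(0 <= k < N) a k *: z k) <= eps.
Proof.
have sp k : seminorm (p k) by case: frX.
have cp : continuous (p n) by exact: frechet_seminorm_continuous.
have [q [sq cq _ [Bq [Bp [jq [jp [T]]]]]]] := nuX (p n) (sp n) cp.
move=> [[nq _] [np djp] Tj] [lam [f [y [cvl fle yle cvT]]]].
have [m [K [K0 qK]]] := continuous_seminorm_dominated frX sq cq.
exists m => eps eps0.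
pose S N : R := \sum_(0 <= k < N) `|lam k|.
have S0 N : 0 <= S N by apply: sumr_ge0.
have e3 : 0 < eps / 3 by rewrite divr_gt0.
have [N tail] : exists N, forall M, (N <= M)%N ->
    K * \sum_(N <= k < M) `|lam k| <= eps / 3.
  have Snd : {homo S : i j / (i <= j)%N >-> i <= j}.
    by apply: (@nondecreasing_series _ (fun k => `|lam k|) xpredT).
  have /cvgrPdist_lt /(_ (eps / 3 / K) (divr_gt0 e3 K0)) [N _ HN] := cvl.
  exists N => M NM; rewrite -ler_pdivlMl// mulrC.
  have -> : \sum_(N <= k < M) `|lam k| = S M - S N.
    by rewrite /S (big_cat_nat (leq0n N) NM) /= addrAC subrr add0r.
  have := nondecreasing_cvgn_le Snd cvl M.
  have := HN N (leqnn N); rewrite /= -/(S N) => /ltW/ler_normlW.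
  by rewrite /S /series /=; lra.
pose d := eps / 3 / (K * S N + 1).
have KS0 : 0 < K * S N + 1 by rewrite ltr_wpDl// mulr_ge0// ltW.
have d0 : 0 < d by rewrite divr_gt0.
have /choice [z zP] : forall k, exists z : X, `|y k - jp z| <= d%:C.
  move=> k.
  have [] := djp (ball (y k) d%:C).
  - by exists (y k); apply: ballxx; rewrite ltcR.
  - exact: ball_open.
  - move=> w [bw [z _ zw]]; exists z.
    by move: bw; rewrite -zw -ball_normE => /ltW.
exists N, z, (fun k => `|lam k| * K) => x px.
pose a k := (lam k)%:C * f k (jq x).
have aK k : `|a k| <= (`|lam k| * K)%:C.
  rewrite normrM normc_real rmorphM ler_wpM2l ?ler0c//.
  rewrite (le_trans (fle _ _))// nq lecR (le_trans (qK x))//.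
  by rewrite -[leRHS]mulr1 ler_wpM2l// ltW.
exists a; split => //.
(* N serves the whole ball, whereas M may depend on x: the terms from N to M
   are bounded uniformly in M *)
have [M NM TM] : exists2 M, (N <= M)%N &
    `|T (jq x) - \sum_(0 <= k < M) a k *: y k| <= (eps / 3)%:C.
  have e3c : 0 < (eps / 3)%:C by rewrite ltcR.
  have /cvgrPdist_le /(_ _ e3c) [M _ HM] := cvT (jq x).
  by exists (maxn N M); [exact: leq_maxl|exact: (HM _ (leq_maxr _ _))].
rewrite -lecR -np linearB -Tj linear_sum.
under eq_bigr do rewrite linearZ.
have -> : T (jq x) - \sum_(0 <= k < N) a k *: jp (z k) =
    (T (jq x) - \sum_(0 <= k < M) a k *: y k) + \sum_(N <= k < M) a k *: y k
    + \sum_(0 <= k < N) a k *: (y k - jp (z k)).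
  rewrite (big_cat_nat (leq0n N) NM) /= opprD addrA subrK.
  under [X in _ = _ + X]eq_bigr do rewrite scalerBr.
  by rewrite sumrB addrA subrK.
have -> : (eps%:C = (eps / 3)%:C + (eps / 3)%:C + (eps / 3)%:C :> R[i]).
  by rewrite -!rmorphD; congr (_%:C); lra.
rewrite (le_trans (ler_normD _ _))// lerD//.
  rewrite (le_trans (ler_normD _ _))// lerD//.
  have := tail M NM; rewrite -lecR; apply: le_trans.
  rewrite (le_trans (ler_norm_sum _ _ _))//.
  rewrite mulr_sumr rmorph_sum ler_sum// => k _.
  rewrite normrZ -[leRHS]mulr1 ler_pM//.
  by rewrite mulrC.
have h : d * (K * S N) <= eps / 3.
  rewrite /d mulrAC ler_pdivrMr// ler_pM2l//; lra.
rewrite -lecR in h; apply: le_trans h.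
rewrite (le_trans (ler_norm_sum _ _ _))//.
rewrite !mulr_sumr rmorph_sum ler_sum// => k _.
rewrite normrZ mulrC rmorphM ler_pM//.
by rewrite mulrC.
Qed.

(** * Regular differentiability *)

Section DifferentiableFamily.
Variables (R : realType) (X : tvsType R[i]) (p : nat -> X -> R).
Variables (Omega : R -> {linear X -> X}) (t0 : R).
Hypothesis frX : frechet_space p.
Hypothesis cOmega : forall t, continuous (Omega t).

Let sp n : seminorm (p n). Proof. by case: frX. Qed.
Let DQ := diff_quotient Omega t0.

Let near_and (P Q : R -> Prop) : (\forall t \near t0^', P t) ->
  (\forall t \near t0^', Q t) -> \forall t \near t0^', P t /\ Q t.
Proof. exact: (@filterI _ t0^'). Qed.

Let near_ex (P Q : R -> Prop) : (\forall t \near t0^', P t) ->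
  (\forall t \near t0^', Q t) -> exists t, P t /\ Q t.
Proof. by move=> nP nQ; apply: (@filter_ex _ t0^'); exact: near_and. Qed.

Lemma diff_quotient_is_linear t : linear (DQ t).
Proof.
move=> a u v; rewrite /DQ /diff_quotient !linearP /= addrACA -scalerDr.
by rewrite [LHS]scalerDr !scalerA mulrC.
Qed.

Lemma diff_quotient_continuous t : continuous (DQ t).
Proof.
move=> x.
apply: (continuous2_cvg (F := nbhs x) (V := R[i]^o) (W := X) (U := X) _
  (f := fun=> _) (h := fun a v => a *: v)).
- exact: (@scale_continuous _ X (_, _)).
- exact: cvg_cst.
- apply: (continuous2_cvg (F := nbhs x) (V := X) (W := X) (U := X) _
    (h := fun u v => u - v)).
  + exact: (@sub_continuous X (_, _)).
  + exact: cOmega.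
  + exact: cOmega.
Qed.

Lemma seminorm_comp_linear (f : X -> X) n :
  linear f -> seminorm (fun x => p n (f x)).
Proof.
move=> lf; split=> [x y|a x].
  by rewrite -[x]scale1r lf !scale1r seminormD.
have f0 : f 0 = 0.
  by have := lf (-1) 0 0; rewrite scaler0 addr0 scaleN1r addNr.
by rewrite -[a *: x]addr0 lf f0 addr0 (sp n).2.
Qed.

Hypothesis dOmega : differentiable_at Omega t0.

(** The countable base of the punctured neighbourhoods of [t0] consists of the
    punctured balls of radius [1 / k.+1]. *)
Lemma diff_quotient_equicontinuous n : exists m C, 0 < C /\
  \forall t \near t0^', forall x, p n (DQ t x) <= C * p m x.
Proof.
apply: (uniform_boundedness frX (q := fun t x => p n (DQ t x))
  (B := fun k => ball t0 k.+1%:R^-1 `\ t0)).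
- by move=> k; apply: dnbhs_ball; rewrite invr_gt0.
- move=> k l kl t [tl tt0]; split=> //; apply: le_ball tl.
  by rewrite lef_pV2 ?posrE// ler_nat.
- move=> A [e /= e0 eA]; exists (Num.trunc e^-1) => t [te tt0].
  move: te; rewrite -ball_normE /= => te; apply: eA => /=; last exact/eqP.
  apply: lt_trans te _.
  by rewrite -[ltRHS]invrK ltf_pV2 ?posrE ?invr_gt0// truncnS_gt.
- by move=> t; apply: seminorm_comp_linear; exact: diff_quotient_is_linear.
- move=> t x; apply: (continuous_comp (@diff_quotient_continuous t x)).
  exact: frechet_seminorm_continuous.
- move=> x; have [l xl] := dOmega x; exists (p n l + 1).
  have near1 : \forall t \near t0^', p n (DQ t x - l) < 1.
    exact: ((frechet_cvgP frX l _).1 xl n 1 ltr01).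
  apply: filterS near1 => t h; rewrite -[DQ t x](subrK l).
  rewrite (le_trans (seminormD _ _ _))//.
  by rewrite addrC lerD2l ltW.
Qed.

(** Linear relations and the bound of [diff_quotient_equicontinuous] pass to
    the pointwise limit, so the derivative is a continuous operator. *)
Lemma derivative_exists : exists2 D : {linear X -> X}, continuous D &
  forall x n e, 0 < e -> \forall t \near t0^', p n (DQ t x - D x) < e.
Proof.
have [D cvD] := choice dOmega.
have DP x n e : 0 < e -> \forall t \near t0^', p n (DQ t x - D x) < e.
  by move=> e0; exact: (frechet_cvgP frX (D x) _).1 (cvD x) n e e0.
have linD : linear D.
  move=> a u v; apply: subr0_eq; apply: (frechet_eq0 frX) => n.
  apply/eqP; rewrite eq_le seminorm_ge0// andbT.
  have [c c0 ac] : exists2 c : R, 0 <= c & `|a| = c%:C.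
    by rewrite normc_def; set c := Num.sqrt _; exists c => //; exact: sqrtr_ge0.
  apply/ler_addgt0Pr => e e0; rewrite add0r.
  have d0 : 0 < e / (c + 2) by rewrite divr_gt0// ltr_wpDl.
  have [t [[h1 h2] h3]] := near_ex (near_and (DP (a *: u + v) n _ d0)
    (DP u n _ d0)) (DP v n _ d0).
  have -> : D (a *: u + v) - (a *: D u + D v) =
      (a *: (DQ t u - D u) + (DQ t v - D v))
      - (DQ t (a *: u + v) - D (a *: u + v)).
    rewrite diff_quotient_is_linear scalerBr addrACA -opprD opprB.
    by rewrite [RHS]addrC addrA subrK.
  have -> : e = c * (e / (c + 2)) + e / (c + 2) + e / (c + 2).
    by field; rewrite gt_eqF// ltr_wpDl.
  rewrite (le_trans (seminormB _ _ _))// lerD ?(ltW h1)//.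
  rewrite (le_trans (seminormD _ _ _))// lerD ?(ltW h3)//.
  rewrite (le_trans (seminormZ_le (sp n) (c := c) _ _)) ?ac ?seminorm_ge0//.
  by rewrite ler_wpM2l// ltW.
pose DL : {linear X -> X} := HB.pack D (GRing.isLinear.Build _ _ _ _ D linD).
exists DL => [x|]; last exact: DP.
apply/(frechet_cvgP frX) => n e e0.
have [m [C [C0 nearC]]] := diff_quotient_equicontinuous n.
have e20 : 0 < e / 2 by rewrite divr_gt0.
suff : \forall y \near x, p n (DL y - DL x) < e by [].
apply: filterS (frechet_nbhs frX x m (divr_gt0 e20 C0)) => y yx.
have [t [tC ty]] := near_ex nearC (DP (y - x) n (e / 2) e20).
have -> : DL y - DL x = DL (y - x) by rewrite linearB.
rewrite -[DL _](subrK (DQ t (y - x))) [e]splitr.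
rewrite (le_lt_trans (seminormD _ _ _))// ltr_leD//.
  by rewrite -opprB seminormN.
by rewrite (le_trans (tC _))// -ler_pdivlMl// mulrC ltW.
Qed.

(** Pointwise convergence of an equicontinuous family is uniform on totally
    bounded sets, and nuclearity makes the unit ball of some [p m] totally
    bounded for the seminorm controlling the difference quotients. *)
Theorem differentiable_regularly_differentiable : nuclear_space X ->
  regularly_differentiable_at p Omega t0.
Proof.
move=> nuX; have [D cD DP] := derivative_exists; exists D => // n.
have [m [C [C0 nearC]]] := diff_quotient_equicontinuous n.
have [m' tb] := nuclear_ball_totally_bounded frX nuX m.
exists m'.
pose E t x := p n (DQ t x - D x).
have sE t : seminorm (E t).
  apply: (@seminorm_comp_linear (fun x => DQ t x - D x) n) => a u v.
  by rewrite diff_quotient_is_linear (linearP D) opprD addrACA -scalerBr.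
have DC x : p n (D x) <= C * p m x.
  apply/ler_addgt0Pr => e e0.
  have [t [tC tx]] := near_ex nearC (DP x n e e0).
  have -> : D x = DQ t x - (DQ t x - D x) by rewrite opprB addrC subrK.
  by rewrite (le_trans (seminormB _ _ _))// lerD// ltW.
have nearE x : forall e, 0 < e -> \forall t \near t0^', E t x < e.
  by move=> e e0; exact: DP.
have nearEm : \forall t \near t0^', forall x, E t x <= 2 * C * p m x.
  apply: filterS nearC => t tC x; rewrite /E (le_trans (seminormB _ _ _))//.
  by move: (tC x) (DC x); lra.
have near_sum (N : nat) (z : nat -> X) (c : nat -> R) e : 0 < e ->
    \forall t \near t0^', \sum_(0 <= k < N) c k * E t (z k) <= e.
  elim: N e => [|N IH] e e0; first by apply: nearW => t; rewrite big_nil ltW.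
  have e20 : 0 < e / 2 by rewrite divr_gt0.
  have c0 : 0 < `|c N| + 1 by rewrite ltr_wpDl.
  have := near_and (IH _ e20) (nearE (z N) _ (divr_gt0 e20 c0)).
  apply: filterS => t [h1 h2]; rewrite big_nat_recr//= [e]splitr lerD//.
  have Et := seminorm_ge0 (sE t) (z N).
  by move: h2 (ler_wpM2r Et (ler_norm (c N))); rewrite ltr_pdivlMr//; lra.
have bound e : 0 < e ->
    \forall t \near t0^', forall x, p m' x <= 1 -> E t x <= e.
  move=> e0; have e40 : 0 < e / (4 * C) by rewrite divr_gt0// mulr_gt0.
  have [N [z [c tbz]]] := tb _ e40.
  have := near_and nearEm (near_sum N z c (e / 2) (divr_gt0 e0 (ltr0n _ 2))).
  apply: filterS => t [tC tS] x /tbz [a [ac xa]].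
  rewrite -[x](subrK (\sum_(0 <= k < N) a k *: z k)).
  rewrite (le_trans (seminormD (sE t) _ _))// [e]splitr lerD//.
    rewrite (le_trans (tC _))//.
    have -> : e / 2 = 2 * C * (e / (4 * C)) by field; rewrite gt_eqF.
    by rewrite ler_wpM2l// mulr_ge0// ltW.
  apply: le_trans tS; rewrite (le_trans (seminorm_sum (sE t) _ _))//.
  by apply: ler_sum => k _; apply: seminormZ_le => //; exact: seminorm_ge0.
pose Q t := ereal_sup [set (E t x)%:E | x in [set x | p m' x <= 1]].
have Q0 t : (0 <= Q t)%E.
  apply: le_ereal_sup_tmp; exists 0%:E => //.
  exists 0; last by rewrite seminorm0.
  by rewrite /= seminorm0.
have Qe e : 0 < e -> \forall t \near t0^', (Q t <= e%:E)%E.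
  move=> e0; apply: filterS (bound e e0) => t tE.
  by apply/ereal_supP => _ [x px <-]; rewrite lee_fin tE.
suff : Q t @[t --> t0^'] --> 0%:E by [].
have fin t e : (Q t <= e%:E)%E -> Q t \is a fin_num.
  by move=> Qte; rewrite ge0_fin_numE// (le_lt_trans Qte)// ltry.
apply/fine_cvgP; split; first by apply: filterS (Qe 1 ltr01) => t /fin.
apply/cvgrPdist_le => e e0; apply: filterS (Qe e e0) => t Qte.
rewrite sub0r normrN ger0_norm ?fine_ge0//.
by rewrite -lee_fin fineK// (fin _ _ Qte).
Qed.

End DifferentiableFamily.

Local Close Scope ring_scope.
Local Close Scope classical_set_scope.

Theorem theorem5p8 (R : realType) (X : tvsType R[i]) (p : nat -> X -> R)
    (frechetX : frechet_space p)
    (hilbertian_p : forall n, hilbertian_seminorm (p n))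
    (nuclearX : nuclear_space X)
    (Omega : R -> {linear X -> X}%R)
    (groupOmega : one_parameter_subgroup Omega)
    (diffOmega : differentiable_family Omega) :
  regular_family p Omega.
Proof.
move=> t0; case: groupOmega => cOmega _ _.
exact: differentiable_regularly_differentiable.
Qed.
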